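(* Let $T_1$ and $T_2$ be two finite oriented trees satisfying $T_1<T_2$ in the homomorphism order. If $T_2$ is a proper tree, then there exists a finite oriented tree $T$ such that $T_1<T<T_2$.
   Context: All digraphs are finite. A digraph $G$ is a pair $(V(G),A(G))$ with $V(G)$ a set of vertices and $A(G)$ a binary irreflexive relation on $V(G)$ (the arcs; the arc $(u,v)$ is written $uv$). A path is a digraph consisting of a sequence of different vertices $v_0,\dots,v_k$ together with a sequence of different arcs $e_1,\dots,e_k$ such that each $e_i$ is an arc joining $v_{i-1}$ and $v_i$ (in either direction, i.e. $e_i=v_{i-1}v_i$ or $e_i=v_iv_{i-1}$). A cycle is defined analogously but with $v_0=v_k$ (and $k\ge 1$); arcs may again be oriented in either direction. A tree (oriented tree) is a connected digraph (connectedness ignoring arc directions) containing no cycles. A homomorphism $f:G\to H$ of digraphs is a map $f:V(G)\to V(H)$ such that $uv\in A(G)$ implies $f(u)f(v)\in A(H)$. Write $G\le H$ if there is a homomorphism from $G$ to $H$, and $G<H$ if $G\le H$ and $H\not\le G$. Digraphs $G,H$ are homomorphically equivalent if $G\le H$ and $H\le G$. The core of a digraph is its minimal homomorphically equivalent subgraph (unique up to isomorphism). An oriented tree is proper if its core is not a path. *)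

(* Defs.v *)
From mathcomp Require Import all_boot.

Set Implicit Arguments.
Unset Strict Implicit.
Unset Printing Implicit Defensive.

Record digraph := Digraph {
  vertex :> finType;
  is_arc : rel vertex;
  is_arc_irr : irreflexive is_arc }.

Section Walks.
Variable G : digraph.

(* The arc [e] is traversed between [x] and [y], in either direction. *)
Definition joins (e : G * G) (x y : G) : bool :=
  (e == (x, y)) || (e == (y, x)).

(* A sequence v_0, e_1, v_1, ..., e_k, v_k is encoded by [x = v_0] and
   [s = [:: (e_1, v_1); ...; (e_k, v_k)]], so that [unzip1 s] lists the arcs
   and [unzip2 s] the vertices v_1, ..., v_k. *)
Fixpoint walk (x : G) (s : seq ((G * G) * G)) : bool :=
  if s is (e, y) :: s' then [&& is_arc e.1 e.2, joins e x y & walk y s'] else true.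

Definition path_in (x : G) (s : seq ((G * G) * G)) : bool :=
  [&& walk x s, uniq (x :: unzip2 s) & uniq (unzip1 s)].

(* The vertices v_1, ..., v_k = v_0 are distinct, and so are the arcs; since
   only the arcs are required to differ, a pair of opposite arcs is a cycle
   with k = 2. *)
Definition cycle_in (x : G) (s : seq ((G * G) * G)) : bool :=
  [&& walk x s, s != [::], last x (unzip2 s) == x,
      uniq (unzip2 s) & uniq (unzip1 s)].

Definition is_path : Prop :=
  exists (x : G) (s : seq ((G * G) * G)),
    [/\ path_in x s,
        forall y : G, y \in x :: unzip2 s &
        forall y z : G, is_arc y z -> (y, z) \in unzip1 s].

Definition connected : Prop :=
  0 < #|G| /\
  forall x y : G, connect (fun u v : G => is_arc u v || is_arc v u) x y.

Definition is_tree : Prop :=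
  connected /\ forall (x : G) (s : seq ((G * G) * G)), ~ cycle_in x s.

End Walks.

Definition is_hom (G H : digraph) (f : G -> H) : Prop :=
  forall x y : G, is_arc x y -> is_arc (f x) (f y).

Definition hom_le (G H : digraph) : Prop := exists f : G -> H, is_hom f.

Definition hom_lt (G H : digraph) : Prop := hom_le G H /\ ~ hom_le H G.

Definition hom_equiv (G H : digraph) : Prop := hom_le G H /\ hom_le H G.

(* Subgraphs need not be induced. *)
Record subgraph (G : digraph) := Subgraph {
  sub_vertices : {set G};
  sub_arcs : {set G * G};
  sub_arcsP : forall x y : G, (x, y) \in sub_arcs ->
    [&& x \in sub_vertices, y \in sub_vertices & is_arc x y] }.

Section SubgraphDigraph.
Variables (G : digraph) (S : subgraph G).

Definition subgraph_arc : rel {x : G | x \in sub_vertices S} :=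
  fun x y => (val x, val y) \in sub_arcs S.

Lemma subgraph_arc_irr : irreflexive subgraph_arc.
Proof.
move=> x; apply/negP => /sub_arcsP /and3P[_ _].
by rewrite is_arc_irr.
Qed.

Definition digraph_of_subgraph : digraph := Digraph subgraph_arc_irr.

End SubgraphDigraph.

Coercion digraph_of_subgraph : subgraph >-> digraph.

Definition subgraph_le (G : digraph) (S S' : subgraph G) : Prop :=
  sub_vertices S \subset sub_vertices S' /\ sub_arcs S \subset sub_arcs S'.

Definition is_core (G : digraph) (C : subgraph G) : Prop :=
  hom_equiv C G /\
  forall S : subgraph G, hom_equiv S G -> subgraph_le S C -> subgraph_le C S.

(* The core exists and is unique up to isomorphism, so quantifying over all
   cores is the same as choosing one. *)
Definition is_proper (G : digraph) : Prop :=
  forall C : subgraph G, is_core C -> ~ is_path C.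

(* Main.v *)
Require Import Defs.
From mathcomp Require Import all_boot all_fingroup zify.

(** Let [H] be the core of [T2]. It is a tree, all its endomorphisms are
    injective ([core_exists]), and as it is not a path, it has a vertex [v] with
    three neighbours [a], [b], [c] ([nonbranching_path]). They head three branches
    at [v]; call the rest of [H], which contains [v], the fourth piece. The tree
    [T] between [T1] and [H] consists of [T1] and a long caterpillar over [H]
    attached to it.

    The spine of the caterpillar lies over a walk ..., [a], [v], [b], [v], [c],
    [v], [a], ... in which the neighbours of [v] recur cyclically. Each copy of a
    neighbour carries its branch, and each copy of [v] carries the fourth piece.
    Hence a copy of [v] sees only two of the three branches, and [H] does not map
    to the caterpillar over itself. Nevertheless a homomorphism from a long
    caterpillar to a finite tree [T1] forces one from [H] to [T1]
    ([backtrack_hom], [caterpillar_bound]). Indeed the spine is mapped to a walk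
    in [T1]. If it is long, it backtracks somewhere
    ([nonbacktracking_bound]). If the step back happens at a copy of a neighbour
    of [v], two consecutive copies of [v] have the same image, which therefore
    sees the images of all three branches. If it happens at a copy of [v], two of
    the neighbours, say [a] and [b], have the same image; the next copy of [v] on
    the spine is joined to [b] and [c], so its image sees the image of the branch
    of [a], too.

    The caterpillar is attached to [T1] by an undecorated path. If [H] had a
    homomorphism to [T], then [T], as a digraph over [H], would have a section
    ([rigid_section]). The section cannot take [v] to the path or the
    caterpillar, whose vertices over [v] do not have neighbours over all of [a],
    [b], [c]. To exclude that it takes [v] into [T1], the path begins with a
    zigzag over an edge of [T1], longer than the depth of [H]: the image of the
    section is then contained in [T1] with the zigzag, which folds back
    into [T1] ([graft_no_section]). If [T1] has no arcs, it is first replaced by a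
    single arc, which still lies strictly below [H]. *)

Set Implicit Arguments.
Unset Strict Implicit.
Unset Printing Implicit Defensive.

(** * Rooted trees *)

Definition adj (G : digraph) (x y : G) : bool := is_arc x y || is_arc y x.

Lemma adj_sym (G : digraph) : symmetric (@adj G).
Proof. by move=> x y; rewrite /adj orbC. Qed.

Lemma adj_irr (G : digraph) : irreflexive (@adj G).
Proof. by move=> x; rewrite /adj is_arc_irr. Qed.

Definition asymmetric (G : digraph) : Prop :=
  forall x y : G, is_arc x y -> ~~ is_arc y x.

(** A pair of opposite arcs is a cycle of length two. *)
Lemma tree_asym (G : digraph) : is_tree G -> asymmetric G.
Proof.
move=> [_ acy] x y xy; apply/negP => yx.
have nxy : y != x by apply/eqP => e; move: xy; rewrite e is_arc_irr.
apply: (acy x [:: ((x, y), y); ((y, x), x)]).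
by rewrite /cycle_in /= /joins xy yx !eqxx !inE !xpair_eqE /= (negbTE nxy) andbF.
Qed.

Section WalkOf.
Variable G : digraph.

Definition arc_of (x y : G) : G * G := if is_arc x y then (x, y) else (y, x).

Definition walk_of (x : G) (p : seq G) : seq ((G * G) * G) :=
  pairmap (fun u w => (arc_of u w, w)) x p.

Lemma walk_of_vertices x p : unzip2 (walk_of x p) = p.
Proof. by elim: p x => //= y p IH x; rewrite IH. Qed.

Lemma walk_of_rcons x p y :
  walk_of x (rcons p y) = rcons (walk_of x p) (arc_of (last x p) y, y).
Proof. by elim: p x => //= z p IH x; rewrite IH. Qed.

Lemma walk_of_walk x p : path (@adj G) x p -> walk x (walk_of x p).
Proof.
elim: p x => //= y p IH x /andP[xy /IH->]; rewrite andbT /arc_of /joins.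
by case: ifP xy => /= [->|]; rewrite ?eqxx /adj ?orbT // => -> /= ->.
Qed.

Lemma walk_ends (x : G) s e : walk x s -> e \in unzip1 s ->
  (e.1 \in x :: unzip2 s) && (e.2 \in x :: unzip2 s).
Proof.
elim: s x => //= [[e' y] s] IH x /= /and3P[_ j w].
rewrite inE => /predU1P[->|/(IH _ w)]; last first.
  by case/andP => h1 h2; rewrite !(in_cons x) h1 h2 !orbT.
by case/orP: j => /eqP-> /=; rewrite !inE !eqxx !orbT.
Qed.

(** An arc used twice would bring the walk back to one of its ends. *)
Lemma walk_uniq_arcs (x : G) s :
  walk x s -> uniq (x :: unzip2 s) -> uniq (unzip1 s).
Proof.
elim: s x => // [[e y] s] IH x /and3P[_ j w] /andP[xn u].
rewrite /= (IH _ w u) andbT; apply: contra xn => /(walk_ends w)/andP[h1 h2].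
by case/orP: j h1 h2 => /eqP->.
Qed.

End WalkOf.

(** A path from [x] to [y] that avoids the edge between them would close up
    with this edge to a cycle. *)
Lemma tree_bridge (G : digraph) (x y : G) : is_tree G -> adj x y ->
  ~~ connect (fun u w => [&& adj u w, (u, w) != (x, y) & (u, w) != (y, x)]) x y.
Proof.
move=> tG xy; have acy := tG.2; have asG := tree_asym tG.
apply/negP => /connectP[p0 pth0 lst0]; case: (shortenP pth0) lst0 => p pth u _ lst.
have padj : path (@adj G) x p.
  by apply: sub_path pth => ? ? /and3P[].
have avoid : ((x, y) \notin unzip1 (walk_of x p)) && ((y, x) \notin unzip1 (walk_of x p)).
  move: pth; move: {3 5 7}x => u0; elim: p u0 {u lst padj} => //= z p IH u.
  move=> /andP[/and3P[_ n1 n2] /IH /andP[h1 h2]].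
  rewrite !inE !negb_or h1 h2 !andbT /arc_of; move: n1 n2.
  by case: ifP => _ n1 n2; apply/andP; split; apply/eqP => -[e1 e2];
     move: n1 n2; rewrite e1 e2 eqxx.
apply: (acy x (walk_of x (rcons p x))).
rewrite /cycle_in walk_of_walk ?rcons_path ?padj -?lst 1?adj_sym //.
rewrite walk_of_vertices last_rcons eqxx rcons_uniq.
rewrite -[(x \notin p) && _]/(uniq (x :: p)) u walk_of_rcons [unzip1 _]map_rcons rcons_uniq.
rewrite -[map _ _]/(unzip1 _) (walk_uniq_arcs (walk_of_walk padj)) ?walk_of_vertices //=.
rewrite -lst !andbT; apply/andP; split; first by case: (walk_of x p).
by rewrite /arc_of; case/andP: avoid; case: ifP.
Qed.

Lemma bfs (T : finType) (e : rel T) r : (forall x, connect e r x) ->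
  exists (par : T -> T) (h : T -> nat), h r = 0 /\
    forall x, x != r -> e (par x) x /\ h x = (h (par x)).+1.
Proof.
move=> conn.
pose D x n := [exists p : n.-tuple T, path e r p && (last r p == x)].
have DP x p : path e r p -> last r p = x -> D x (size p).
  by move=> pp lp; apply/existsP; exists (in_tuple p); rewrite pp lp eqxx.
have exD x : exists n, D x n.
  by have /connectP[p pp lp] := conn x; exists (size p); apply: DP.
pose h x := ex_minn (exD x).
have hmin x p : path e r p -> last r p = x -> h x <= size p.
  by rewrite /h; case: ex_minnP => m _ mn pp lp; apply/mn/DP.
have [q qP] : exists q : T -> T, forall x, x != r -> e (q x) x /\ h x = (h (q x)).+1.
  exists (fun x => odflt x [pick y | e y x && (h x == (h y).+1)]) => x xr.
  case: pickP => [y /andP[? /eqP //]|no] /=.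
  have : D x (h x) by rewrite /h; case: ex_minnP.
  case/existsP => -[p /= /eqP sp] /andP[pp /eqP lp].
  case/lastP: p => [|p z] in sp pp lp *; first by rewrite -lp eqxx in xr.
  move: pp lp sp; rewrite rcons_path last_rcons size_rcons => /andP[pp ez] zx sp.
  subst z; have := no (last r p); rewrite ez /= => /negbT/eqP[].
  apply/eqP; rewrite eqn_leq -{2}sp ltnS (hmin _ p) // andbT.
  have : D (last r p) (h (last r p)) by rewrite /h; case: ex_minnP.
  case/existsP => -[p' /= /eqP sp'] /andP[pp' /eqP lp'].
  rewrite -sp' -(size_rcons p' x); apply: hmin; last by rewrite last_rcons.
  by rewrite rcons_path pp' lp'.
by exists q, h; split=> //; apply/eqP; rewrite -leqn0 (hmin r [::]).
Qed.

(** The form in which trees are handled below: every edge joins a vertex to its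
    parent [par], and [h] is the distance to the root [r]. Together with the
    absence of opposite arcs this characterises trees ([tree_rooting] and
    [rooting_tree]), and it is easy to write down for a tree glued from pieces. *)
Definition rooting (G : digraph) (r : G) (par : G -> G) (h : G -> nat) : Prop :=
  [/\ h r = 0,
      forall x, x != r -> adj x (par x) /\ h x = (h (par x)).+1 &
      forall x y, adj x y -> (x != r /\ y = par x) \/ (y != r /\ x = par y)].

(** The parent of a vertex is its predecessor in a breadth-first search. An edge
    that does not join a vertex to its parent lies on no parent chain; its ends
    are then linked through the root without it, so it is not a bridge. *)
Lemma tree_rooting (G : digraph) (r : G) :
  is_tree G -> exists par h, @rooting G r par h.
Proof.
move=> tG; have [par [h [h0 hP]]] := bfs (tG.1.2 r).
exists par, h; split=> // [x xr|x y xy].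
  by have [] := hP x xr; split=> //; rewrite adj_sym.
pose e' u w := [&& @adj G u w, (u, w) != (x, y) & (u, w) != (y, x)].
have e's : symmetric e'.
  move=> u w; rewrite /e' adj_sym !xpair_eqE; congr (_ && _).
  by rewrite andbC; congr (~~ _ && ~~ _); rewrite andbC.
case: (boolP ((x != r) && (y == par x))) => [/andP[? /eqP]|n1]; first by left.
case: (boolP ((y != r) && (x == par y))) => [/andP[? /eqP]|n2]; first by right.
have toroot z : connect e' z r.
  have [n] := ubnP (h z); elim: n z => // n IH z.
  have [->|zr] := eqVneq z r; first by rewrite connect0.
  have [ez hz] := hP z zr; rewrite ltnS hz => /IH; apply: connect_trans.
  apply: connect1; rewrite /e' -[adj z _]/(is_arc _ _ || is_arc _ _) orbC ez /=.
  apply/andP; split; [apply: contra n1|apply: contra n2];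
    by rewrite xpair_eqE => /andP[/eqP<- /eqP<-]; rewrite zr eqxx.
case/negP: (tree_bridge tG xy).
by apply: connect_trans (toroot x) _; rewrite (sym_connect_sym e's).
Qed.

Section Rooting.
Variables (G : digraph) (r : G) (par : G -> G) (h : G -> nat).
Hypothesis rG : rooting r par h.

Lemma rooting_adj x y : adj x y ->
  (y = par x /\ h x = (h y).+1) \/ (x = par y /\ h y = (h x).+1).
Proof.
case: rG => _ hP aP /aP[[n ->]|[n ->]]; [left|right]; by have [] := hP _ n.
Qed.

Lemma rooting_up x y : adj x y -> h y <= h x -> y = par x.
Proof. by move/rooting_adj => [[]|[_ ->]] //; rewrite ltnn. Qed.

Lemma rooting_tree : asymmetric G -> is_tree G.
Proof.
move=> asG; have [h0 hP aP] := rG; split.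
  have toroot z : connect (@adj G) z r.
    have [n] := ubnP (h z); elim: n z => // n IH z.
    have [->|zr] := eqVneq z r; first by rewrite connect0.
    have [ez hz] := hP z zr; rewrite ltnS hz => /IH; apply: connect_trans.
    exact: connect1.
  split; first by apply/card_gt0P; exists r.
  move=> x y; apply: connect_trans (toroot x) _.
  by rewrite (sym_connect_sym (@adj_sym G)).
(* Both neighbours on the cycle of a highest vertex would be its parent. *)
move=> x s /and5P[w sn /eqP lst uv ua].
have same_arc e e' u y z : is_arc e.1 e.2 -> joins e u y -> is_arc e'.1 e'.2 ->
    joins e' y z -> h u <= h y -> h z <= h y -> e = e'.
  move=> ae je ae' je' hu hz.
  have e1 : u = par y.
    apply: rooting_up hu; rewrite /adj.
    by case/orP: je ae => /eqP-> /= ->; rewrite ?orbT.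
  have e2 : z = par y.
    apply: rooting_up hz; rewrite /adj.
    by case/orP: je' ae' => /eqP-> /= ->; rewrite ?orbT.
  move: ae ae'; rewrite e1 -e2 in je.
  case/orP: je => /eqP->; case/orP: je' => /eqP-> //= h1 h2;
  by have := asG _ _ h1; rewrite h2.
have xin : x \in unzip2 s.
  by rewrite -{1}lst; case: (s) sn => //= ? ? _; rewrite mem_last.
pose y := [arg max_(y > x | y \in unzip2 s) h y].
have [yin ymax] : y \in unzip2 s /\ forall z, z \in unzip2 s -> h z <= h y.
  by rewrite /y; case: arg_maxnP.
have wcat x0 s1 s2 : walk x0 (s1 ++ s2) = walk x0 s1 && walk (last x0 (unzip2 s1)) s2.
  by elim: s1 x0 => //= [[e z] s1] IH x0 /=; rewrite IH !andbA.
have [i] := mapP yin; rewrite [i]surjective_pairing; case: i => e y' /= iin /= yy.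
rewrite -{y'}yy in iin.
case/splitPr: iin w sn lst uv ua xin ymax yin => s1 s2 w _ lst uv ua xin ymax yin.
move: w; rewrite wcat /= => /and4P[w1 ae je w2].
set u := last x (unzip2 s1) in je.
have hu : h u <= h y.
  apply: ymax; rewrite /u; case/lastP: (s1) xin => //= s1' q _.
  by rewrite /unzip2 map_rcons last_rcons map_cat map_rcons mem_cat mem_rcons inE eqxx.
case: s2 => [|[e' z] s2] in w2 lst uv ua xin ymax yin *; last first.
  case/and3P: w2 => ae' je' _.
  have ee := same_arc _ _ _ _ _ ae je ae' je' hu _.
  move: ua; rewrite /unzip1 map_cat cat_uniq /= ee ?inE ?eqxx ?andbF //.
  by apply: ymax; rewrite /unzip2 map_cat mem_cat /= !inE eqxx !orbT.
have yx : y = x by move: lst; rewrite /unzip2 map_cat last_cat.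
case: s1 => [|[e' z] s1] in w1 u je hu ua uv xin ymax yin lst *.
  by move: je ae; rewrite /u /= yx => /orP[]/eqP-> /=; rewrite is_arc_irr.
case/and3P: w1 => ae' je' _; rewrite -yx in je'.
have ee := same_arc _ _ _ _ _ ae je ae' je' hu _.
move: ua; rewrite /unzip1 map_cat /= ee ?mem_cat ?inE ?eqxx ?orbT //.
by apply: ymax; rewrite /= !inE eqxx.
Qed.

(** In a rooted tree a walk that never backtracks climbs towards the root for
    some time and, once it has made a step down, can only go further down. Both
    phases are bounded by the height [B]. *)
Lemma nonbacktracking_bound (u : nat -> G) (L B : nat) :
  (forall x, h x <= B) -> (forall i, i < L -> adj (u i) (u i.+1)) ->
  (forall i, i.+1 < L -> u i != u i.+2) -> L <= B.*2.
Proof.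
move=> hB ua unb.
(* Either all steps so far went up, or the last one went down; in the second
   case there were at most [h (u 0)] steps up and [h (u i)] steps down. *)
suff inv i : i <= L -> h (u i) + i = h (u 0) \/
    [/\ 0 < i, h (u i.-1) < h (u i) & i <= h (u 0) + h (u i)].
  have := hB (u 0); have := hB (u L).
  by case: (inv L (leqnn L)) => [|[]]; lia.
elim: i => [|i IH] iL; first by left; rewrite addn0.
have [[up hi]|[up hi]] := rooting_adj (ua i iL).
  case: (IH (ltnW iL)) => [e|[i0 lt le]]; first by left; lia.
  have back : adj (u i) (u i.-1) by rewrite adj_sym -{2}(prednK i0) ua //; lia.
  have := unb i.-1; rewrite prednK // => /(_ iL) /eqP[].
  rewrite (rooting_up back) ?(ltnW lt) // -up //.
by right; case: (IH (ltnW iL)) => [e|[i0 lt le]]; split=> //=; lia.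
Qed.

End Rooting.

Definition branching (G : digraph) (v a b c : G) : Prop :=
  [/\ uniq [:: a; b; c], adj v a, adj v b & adj v c].

(** Root the tree at a leaf, namely a deepest vertex for an arbitrary root. Every
    vertex then has at most one child, so distinct vertices have distinct depths
    and the parent chain of a deepest vertex runs through the whole tree. *)
Lemma nonbranching_path (G : digraph) : is_tree G ->
  (forall v a b c : G, ~ branching v a b c) -> is_path G.
Proof.
move=> tG nobr; have asG := tree_asym tG.
have [r0 _] : exists r0 : G, r0 \in G by apply/card_gt0P; case: tG => -[].
have [par0 [h0 R0]] := tree_rooting r0 tG.
have [z zmax] : exists z, forall x, h0 x <= h0 z.
  by exists [arg max_(x > r0) h0 x] => x; case: arg_maxnP => // ? _; apply.
have zleaf x : adj z x -> x = par0 z by move/(rooting_up R0); apply.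
have {par0 h0 R0 zmax zleaf} [par [h [R zleaf]]] : exists par h,
    rooting z par h /\ forall x y, adj z x -> adj z y -> x = y.
  have [par [h R]] := tree_rooting z tG; exists par, h; split=> // x y.
  by move=> /zleaf-> /zleaf->.
have [hz0 hP aP] := R.
have h_eq0 x : (h x == 0) = (x == z).
  by apply/eqP/eqP => [|-> //]; have [//|/hP[_ ->]] := eqVneq x z.
have par_inj x y : x != z -> y != z -> par x = par y -> x = y.
  move=> xz yz pxy; have [ax hx] := hP x xz; have [ay hy] := hP y yz.
  have [pz|pz] := eqVneq (par x) z.
    by apply: zleaf; rewrite -pz adj_sym // pxy.
  have [ap hp] := hP _ pz; have [//|xy] := eqVneq x y.
  case: (nobr (par x) x y (par (par x))).
  split; [|by rewrite adj_sym|by rewrite pxy adj_sym|by []].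
  rewrite /= !inE negb_or xy /= andbT; apply/andP; split; apply/eqP => e;
    by move: hp hx hy; rewrite -pxy -e; lia.
have h_inj x y : h x = h y -> x = y.
  have [n] := ubnP (h x); elim: n x y => // n IH x y.
  have [->|xz] := eqVneq x z; first by rewrite hz0 => _ /esym/eqP; rewrite h_eq0 => /eqP.
  have [->|yz] := eqVneq y z; first by rewrite hz0 => _ /eqP; rewrite h_eq0 => /eqP.
  move=> lt exy; apply: par_inj => //; have [_ hx] := hP x xz; have [_ hy] := hP y yz.
  by apply: IH; lia.
have [m mmax] : exists m, forall x, h x <= h m.
  by exists [arg max_(x > z) h x] => x; case: arg_maxnP => // ? _; apply.
have hiter k : k <= h m -> h (iter k par m) = h m - k.
  elim: k => [|k IH] km; first by rewrite subn0.
  have hk := IH (ltnW km); have : iter k par m != z by rewrite -h_eq0 hk subn_eq0 -ltnNge.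
  by move/hP => [_]; rewrite hk /=; lia.
have down : path (fun x y => adj x y && (h y < h x)) m (traject par (par m) (h m)).
  have : forall n k, k + n <= h m ->
    path (fun x y => adj x y && (h y < h x)) (iter k par m) (traject par (iter k.+1 par m) n).
    elim=> //= n IH k kn; rewrite (IH k.+1) ?andbT; last by lia.
    have : iter k par m != z by rewrite -h_eq0 hiter; lia.
    by case/hP=> -> ->; rewrite ltnS leqnn.
  by move/(_ (h m) 0); apply.
have w : walk m (walk_of m (traject par (par m) (h m))).
  by apply/walk_of_walk; apply: sub_path down => ? ? /andP[].
exists m, (walk_of m (traject par (par m) (h m))); rewrite /path_in w.
have u : uniq (m :: traject par (par m) (h m)).
  apply: (@sorted_uniq _ (fun x y => h y < h x)) => [? ? ? /= h1 h2|?|].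
  - exact: ltn_trans h2 h1.
  - exact: ltnn.
  - by apply: sub_path down => ? ? /andP[].
have all x : x = iter (h m - h x) par m.
  by apply: h_inj; rewrite hiter ?leq_subr // subKn.
have arcs k : forall n x, k < n -> arc_of (iter k par x) (iter k.+1 par x) \in
    unzip1 (walk_of x (traject par (par x) n)).
  elim: k => [|k IH] [|n] x //= kn; first by rewrite inE eqxx.
  by have := IH n (par x) kn; rewrite inE -!iterSr /= => ->; rewrite orbT.
split=> [|y|y y'].
- by rewrite walk_of_vertices u (walk_uniq_arcs w) ?walk_of_vertices.
- rewrite walk_of_vertices -trajectS; apply/trajectP.
  by exists (h m - h y); [rewrite ltnS leq_subr|].
- move=> yy'; have ay : adj y y' by rewrite /adj yy'.
  have arc x : x != z -> arc_of x (par x) \in unzip1 (walk_of m (traject par (par m) (h m))).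
    move=> xz; have := arcs (h m - h x) (h m) m; rewrite [iter _.+1 _ _]iterS -all.
    by apply; rewrite ltn_subrL lt0n h_eq0 xz (leq_trans _ (mmax x)) // lt0n h_eq0.
  case: (aP _ _ ay) => -[nz e].
    by have := arc _ nz; rewrite -e /arc_of yy'.
  by have := arc _ nz; rewrite -e /arc_of (negbTE (asG _ _ yy')).
Qed.

(** * Homomorphisms and cores *)

Lemma is_hom_comp (G H K : digraph) (f : G -> H) (g : H -> K) :
  is_hom f -> is_hom g -> is_hom (g \o f).
Proof. by move=> hf hg x y /hf /hg. Qed.

Lemma hom_le_trans (G H K : digraph) : hom_le G H -> hom_le H K -> hom_le G K.
Proof. by move=> [f hf] [g hg]; exists (g \o f); apply: is_hom_comp. Qed.

Lemma hom_adj (G H : digraph) (f : G -> H) x y : is_hom f -> adj x y -> adj (f x) (f y).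
Proof. by move=> hf /orP[/hf|/hf] xy; rewrite /adj xy ?orbT. Qed.

Lemma sub_tree (G H : digraph) (f : G -> H) :
  is_hom f -> injective f -> connected G -> is_tree H -> is_tree G.
Proof.
move=> hf fi cG [_ acy]; split=> // x s /and5P[w sn lst uv ua].
pose F (e : (G * G) * G) := ((f e.1.1, f e.1.2), f e.2).
apply: (acy (f x) (map F s)).
have v s' : unzip2 (map F s') = map f (unzip2 s').
  by rewrite /unzip2 -!map_comp.
have a s' : unzip1 (map F s') = map (fun e => (f e.1, f e.2)) (unzip1 s').
  by rewrite /unzip1 -!map_comp.
have ai : injective (fun e : G * G => (f e.1, f e.2)).
  by move=> [? ?] [? ?] [/fi -> /fi ->].
rewrite /cycle_in v a last_map (inj_eq fi) lst (map_inj_uniq fi) (map_inj_uniq ai) uv ua.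
rewrite !andbT; apply/andP; split; last by case: (s) sn.
elim: s x w {sn lst uv ua} => //= [[[e1 e2] y] s] IH x /= /and3P[ae je /IH->].
by rewrite hf // andbT /joins /= !xpair_eqE !(inj_eq fi).
Qed.

Section Core.
Variable G : digraph.

Definition hom_image (k : {ffun G -> G}) : {set G} := [set k x | x in G].

Definition arc_image (k : {ffun G -> G}) : {set G * G} :=
  [set (k e.1, k e.2) | e : G * G & is_arc e.1 e.2].

(** An endomorphism whose image has the least number of vertices and arcs: its
    image [C] is a core. An endomorphism of [C], composed with it, cannot have a
    smaller image, hence is injective. *)
Lemma core_exists : exists C : subgraph G,
  [/\ is_core C,
      exists f : G -> C, is_hom f /\ forall y, exists x, f x = y &
      forall e : C -> C, is_hom e -> injective e].
Proof.
pose homb (k : {ffun G -> G}) := [forall x, forall y, is_arc x y ==> is_arc (k x) (k y)].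
have hombP (k : {ffun G -> G}) : reflect (@is_hom G G k) (homb k).
  apply: (iffP forallP) => [h x y xy|h x].
    by have /forallP/(_ y)/implyP := h x; apply.
  by apply/forallP => y; apply/implyP/h.
pose sz k := #|hom_image k| + #|arc_image k|.
have id_hom : homb [ffun x => x] by apply/hombP => x y; rewrite !ffunE.
have [k hk kmin] : exists2 k : {ffun G -> G}, @is_hom G G k &
    forall k' : {ffun G -> G}, @is_hom G G k' -> sz k <= sz k'.
  exists [arg min_(k < [ffun x => x] | homb k) sz k]; case: arg_minnP => // k hk mk.
    exact/hombP.
  by move=> k' /hombP/mk.
have kP x y : (x, y) \in arc_image k ->
    [&& x \in hom_image k, y \in hom_image k & is_arc x y].
  case/imsetP => -[u w]; rewrite inE /= => uw [-> ->].
  by rewrite !imset_f //= hk.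
pose C := Subgraph kP.
have CG : is_hom (val : C -> G) by move=> x y /kP/and3P[].
have kin x : k x \in sub_vertices C by rewrite imset_f.
pose f x : C := Sub (k x) (kin x).
have hf : is_hom f.
  by move=> x y xy; apply/imsetP; exists (x, y); rewrite ?inE.
have sub_all (k' : G -> G) : @is_hom G G (finfun k') ->
    hom_image (finfun k') \subset hom_image k ->
    arc_image (finfun k') \subset arc_image k ->
    hom_image (finfun k') = hom_image k /\ arc_image (finfun k') = arc_image k.
  move=> /kmin; rewrite /sz => m s1 s2; split; apply/eqP; rewrite eqEcard ?s1 ?s2;
    by have := subset_leq_card s1; have := subset_leq_card s2; lia.
exists C; split.
- split; first by split; [exists val|exists f].
  move=> S [_ [g hg]] [sv sa].
  have hk' : @is_hom G G (finfun (fun x => val (g x))).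
    by move=> x y /hg /sub_arcsP/and3P[_ _]; rewrite !ffunE.
  have iv : hom_image (finfun (fun x => val (g x))) \subset sub_vertices S.
    by apply/subsetP => _ /imsetP[x _ ->]; rewrite ffunE (valP (g x)).
  have ia : arc_image (finfun (fun x => val (g x))) \subset sub_arcs S.
    by apply/subsetP => _ /imsetP[x + ->]; rewrite inE !ffunE => /hg.
  have [e1 e2] := sub_all _ hk' (subset_trans iv sv) (subset_trans ia sa).
  by split; rewrite /= -?e1 -?e2.
- exists f; split=> // y; have /imsetP[x _ e] := valP y.
  by exists x; apply: val_inj; rewrite /= -e.
- move=> e he.
  have hk' : @is_hom G G (finfun (fun x => val (e (f x)))).
    by move=> x y /hf/he/CG; rewrite !ffunE.
  have iv : hom_image (finfun (fun x => val (e (f x)))) \subset hom_image k.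
    by apply/subsetP => _ /imsetP[x _ ->]; rewrite ffunE (valP (e (f x))).
  have ia : arc_image (finfun (fun x => val (e (f x)))) \subset arc_image k.
    by apply/subsetP => _ /imsetP[x + ->]; rewrite inE !ffunE => /hf/he.
  have [e1 _] := sub_all _ hk' iv ia.
  have surj : #|image e C| == #|C|.
    apply/eqP/eq_card => y; rewrite [RHS]inE; apply/imageP.
    have : val y \in hom_image k := valP y; rewrite -e1 => /imsetP[x _].
    by rewrite ffunE => /val_inj ->; exists (f x).
  by move=> x y; have /image_injP := surj; apply.
Qed.

End Core.

(** The endomorphism [g \o k] of [H] is a permutation, so some power of it is the
    identity; a smaller power corrects [k] to a section of [g]. *)
Lemma rigid_section (H T : digraph) (k : H -> T) (g : T -> H) :
  (forall e : H -> H, is_hom e -> injective e) -> is_hom k -> is_hom g ->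
  exists s : H -> T, is_hom s /\ cancel s g.
Proof.
move=> rigid hk hg; pose e := g \o k.
have he : is_hom e by apply: is_hom_comp.
pose p := perm (rigid e he).
exists (k \o iter #[p]%g.-1 e); split.
  apply: is_hom_comp hk; elim: (_.-1) => //= n IH.
  exact: is_hom_comp IH he.
move=> x; rewrite -[LHS]/(iter #[p]%g.-1.+1 e x) prednK ?order_gt0 //.
rewrite -(eq_iter (permE (rigid e he))) -/p -permX expg_order perm1 //.
Qed.

(** * Attaching a decorated path to a tree *)

Section Graft.
Variables (T1 H : digraph) (t : T1) (f : T1 -> H) (N : nat).
Variables (w : nat -> H) (S : nat -> pred H).

(** The graft attaches to the vertex [t] of [T1] a path that lies over the walk
    [w 0], ..., [w N] of [H]; its [i]-th vertex carries a copy of the subtree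
    [S i] of [H], rooted at [w i]. A vertex [inr (i, y)] is the copy of [y] at
    position [i]. The construction is a digraph over [H], through [f] on [T1]
    and through the copied vertex elsewhere. *)
Definition graft_mem (u : T1 + 'I_N.+1 * H) : bool :=
  match u with inl _ => true | inr (i, y) => S i y end.

Definition graft_vertex : finType := {u : T1 + 'I_N.+1 * H | graft_mem u}.

Definition in_link (i j : nat) (y z : H) : bool :=
  [|| i == j, [&& j == i.+1, y == w i & z == w j] |
      [&& i == j.+1, y == w i & z == w j]].

Definition graft_arc : rel graft_vertex := fun u u' =>
  match val u, val u' with
  | inl x, inl x' => is_arc x x'
  | inl x, inr (i, y) => is_arc (f x) y && [&& x == t, i == 0 :> nat & y == w 0]
  | inr (i, y), inl x => is_arc y (f x) && [&& x == t, i == 0 :> nat & y == w 0]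
  | inr (i, y), inr (j, z) => is_arc y z && in_link i j y z
  end.

Lemma graft_arc_irr : irreflexive graft_arc.
Proof. by case=> [[x|[i y]] /= ?]; rewrite /graft_arc /= is_arc_irr. Qed.

Definition graft : digraph := Digraph graft_arc_irr.

Definition base (x : T1) : graft := Sub (inl x : T1 + 'I_N.+1 * H) isT.

(** Total in [i] and [y], with a meaningless value outside of the graft, so that
    later arguments work with natural numbers and vertices of [H] rather than
    with elements of a subtype. *)
Definition twig (i : nat) (y : H) : graft := insubd (base t) (inr (inord i, y)).

Definition label (u : graft) : H :=
  match val u with inl x => f x | inr (_, y) => y end.

Hypothesis f_hom : is_hom f.

Lemma val_twig i y : i <= N -> S i y -> val (twig i y) = inr (inord i, y).
Proof. by move=> iN Siy; rewrite insubdK // unfold_in /= inordK. Qed.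

Variant graft_spec : graft -> Prop :=
  | GraftBase x : graft_spec (base x)
  | GraftTwig i y of i <= N & S i y : graft_spec (twig i y).

Lemma graftP u : graft_spec u.
Proof.
case: u => -[x|[i y]] p; first by rewrite (bool_irrelevance p isT); constructor.
have iN : i <= N by rewrite -ltnS.
suff -> : exist _ (inr (i, y)) p = twig i y by constructor.
by apply: val_inj; rewrite val_twig // inord_val.
Qed.

Lemma arc_base x x' : is_arc (base x) (base x') = is_arc x x'.
Proof. by []. Qed.

Lemma arc_base_twig x i y : i <= N -> S i y ->
  is_arc (base x) (twig i y) = is_arc (f x) y && [&& x == t, i == 0 & y == w 0].
Proof. by move=> iN Siy; rewrite /= /graft_arc val_twig //= inordK. Qed.

Lemma arc_twig_base x i y : i <= N -> S i y ->
  is_arc (twig i y) (base x) = is_arc y (f x) && [&& x == t, i == 0 & y == w 0].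
Proof. by move=> iN Siy; rewrite /= /graft_arc val_twig //= inordK. Qed.

Lemma arc_twig i j y z : i <= N -> S i y -> j <= N -> S j z ->
  is_arc (twig i y) (twig j z) = is_arc y z && in_link i j y z.
Proof. by move=> iN Siy jN Sjz; rewrite /= /graft_arc !val_twig //= !inordK. Qed.

Lemma adj_base_twig x i y : i <= N -> S i y ->
  adj (base x) (twig i y) = adj (f x) y && [&& x == t, i == 0 & y == w 0].
Proof.
by move=> iN Siy; rewrite /adj arc_base_twig // arc_twig_base // andb_orl.
Qed.

Lemma in_link_sym i j y z : in_link i j y z = in_link j i z y.
Proof.
by rewrite /in_link (eq_sym i) [X in _ || X]orbC ![(y == _) && _]andbC.
Qed.

Lemma adj_twig i j y z : i <= N -> S i y -> j <= N -> S j z ->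
  adj (twig i y) (twig j z) = adj y z && in_link i j y z.
Proof.
by move=> iN Siy jN Sjz; rewrite /adj !arc_twig // (in_link_sym j) andb_orl.
Qed.

Lemma label_twig i y : i <= N -> S i y -> label (twig i y) = y.
Proof. by move=> iN Siy; rewrite /label val_twig. Qed.

Lemma label_hom : is_hom label.
Proof.
move=> u u'; case: (graftP u) => [x|i y iN Sy]; case: (graftP u') => [x'|j z jN Sz].
- by rewrite arc_base => /f_hom.
- by rewrite arc_base_twig // label_twig // => /andP[].
- by rewrite arc_twig_base // label_twig // => /andP[].
- by rewrite arc_twig // !label_twig // => /andP[].
Qed.

Lemma base_hom : is_hom base.
Proof. by []. Qed.

Section GraftTree.
Variables (v : H) (parH : H -> H) (d : H -> nat).
Hypothesis rootH : rooting v parH d.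

(** A section [s] sends [v] to a vertex over [v] that has neighbours over [a],
    [b] and [c]. Outside of [T1] each vertex has at most two neighbours that
    are not at its own position, so one of these three would lie at the position
    of [s v], against the hypothesis that no [S i] contains [v] together with
    [a], [b] or [c].
    If [s v] lies in [T1], then the image of [s] stays so close to [T1] that it
    meets only the part of the spine which zigzags over the edge [t t']; folding
    this part back onto that edge gives a homomorphism from [H] to [T1]. *)
Lemma graft_no_section (a b c : H) (t' : T1) (s : H -> graft) :
  asymmetric H -> ~ hom_le H T1 -> branching v a b c ->
  (forall i y, S i v -> y \in [:: a; b; c] -> ~~ S i y) ->
  adj t t' ->
  (forall i y, (exists x, i <= d x) -> S i y = (y == if odd i then f t else f t')) ->
  is_hom s -> ~ cancel s label.
Proof.
move=> asH nle [uabc va vb vc] noS tt' zig hs sK.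
have s_inj := can_inj sK.
case sv: _ / (graftP (s v)) => [x|i y iN Sy].
  pose pos (u : graft) := if val u is inr (i, _) then i.+1 else 0.
  have pos_twig i y : i <= N -> S i y -> pos (twig i y) = i.+1.
    by move=> iN Sy; rewrite /pos val_twig // inordK.
  have pos_adj u u' : adj u u' -> pos u <= (pos u').+1.
    case: (graftP u) => [x0|i y iN Sy]; case: (graftP u') => [x'|j z jN Sz] //.
      by rewrite adj_sym adj_base_twig // => /and4P[_ _ /eqP i0 _]; rewrite pos_twig // i0.
    rewrite adj_twig // !pos_twig // => /andP[_ /or3P[/eqP->|/andP[/eqP-> _]|/andP[/eqP-> _]]];
      by lia.
  have pos_s y : pos (s y) <= d y.
    have [n] := ubnP (d y); elim: n y => // n IH y.
    have [d0 dP _] := rootH; have [->|yv] := eqVneq y v; first by rewrite sv.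
    have [ay dy] := dP y yv; rewrite dy ltnS => /IH IHy.
    by apply: leq_trans (pos_adj _ _ (hom_adj hs ay)) _; rewrite ltnS.
  apply: nle.
  (* The retraction that folds the zigzag onto [t t']. *)
  pose rho (u : graft) := match val u with
    | inl x => x | inr (i, _) => if odd i then t else t' end.
  have rho_twig i y : i <= N -> S i y -> rho (twig i y) = if odd i then t else t'.
    by move=> iN Sy; rewrite /rho val_twig // inordK.
  have back x1 x2 : adj x1 x2 -> is_arc (f x1) (f x2) -> is_arc x1 x2.
    by case/orP=> // /f_hom /asH/negbTE->.
  have tt2 : adj t' t by rewrite adj_sym.
  exists (rho \o s) => y z yz /=; have := hs _ _ yz.
  have := pos_s y; have := pos_s z.
  case: (graftP (s y)) => [x0|i y' iN Sy]; case: (graftP (s z)) => [x'|j z' jN Sz].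
  - by rewrite arc_base.
  - rewrite pos_twig // => jd _; rewrite arc_base_twig // => /and4P[ar /eqP xt /eqP j0 _].
    rewrite rho_twig // j0; subst x0; apply: back => //.
    by move: Sz ar; rewrite zig ?j0; [move=> /eqP->|exists z; lia].
  - rewrite pos_twig // => _ jd; rewrite arc_twig_base // => /and4P[ar /eqP xt /eqP j0 _].
    rewrite rho_twig // j0; subst x'; apply: back => //.
    by move: Sy ar; rewrite zig ?j0; [move=> /eqP->|exists y; lia].
  - rewrite !pos_twig // => jd id; rewrite arc_twig // !rho_twig // => /andP[ar lk].
    move: Sz Sy ar; rewrite !zig; [|by exists y; lia|by exists z; lia].
    move=> /eqP-> /eqP->.
    case/or3P: lk => [/eqP ij|/andP[/eqP ij _]|/andP[/eqP ij _]]; rewrite ij /=;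
      by case: (odd _) => /=; rewrite ?is_arc_irr // => /back; apply.
have yv : y = v by rewrite -(label_twig iN Sy) -sv sK.
subst y.
(* [X] and [Y] are the only possible neighbours of [s v] at other positions. *)
pose X := if i == 0 then base t else twig i.-1 (w i.-1).
pose Y := twig i.+1 (w i.+1).
have two l : l \in [:: a; b; c] -> s l = X \/ s l = Y.
  move=> lin; have vl : adj v l by move: lin; rewrite !inE => /or3P[]/eqP->.
  have := hom_adj hs vl; rewrite sv /X /Y.
  case sl: _ / (graftP (s l)) => [x'|j z jN Sz].
    by rewrite adj_sym adj_base_twig // => /and4P[_ /eqP-> -> _]; left.
  have zl : z = l by rewrite -(label_twig jN Sz) -sl sK.
  subst z; rewrite adj_twig // => /andP[_ /or3P[/eqP ij|
    /and3P[/eqP-> _ /eqP->]|/and3P[/eqP-> _ /eqP->]]].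
  - by rewrite -ij (negbTE (noS _ _ Sy lin)) in Sz.
  - by right.
  - by left.
move: uabc; rewrite /= !inE negb_or andbT => /andP[/andP[/eqP ab /eqP ac] /eqP bc].
have := two a; have := two b; have := two c; rewrite !inE !eqxx !orbT.
move=> /(_ isT) hc /(_ isT) hb /(_ isT) ha.
case: ha hb hc => ea [] eb [] ec; try (by apply: ab; apply: s_inj; rewrite ea eb);
  try (by apply: ac; apply: s_inj; rewrite ea ec);
  by apply: bc; apply: s_inj; rewrite eb ec.
Qed.

Hypothesis S_root : forall i, S i (w i).
Hypothesis S_above : forall i y, S i y -> d (w i) <= d y.
Hypothesis S_parent : forall i y, S i y -> y != w i -> S i (parH y).
Hypothesis w0_adj : adj (f t) (w 0).
Hypothesis w_adj : forall i, i < N -> adj (w i) (w i.+1).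

(** Root [T1] at [t] and let the spine grow away from it. Each [S i] is closed
    under parents up to [w i], so the parent in a copy is the one in [H]. *)
Lemma graft_tree : is_tree T1 -> asymmetric H -> is_tree graft.
Proof.
move=> tT1 asH; have [par1 [h1 root1]] := tree_rooting t tT1.
have [h10 h1P a1P] := root1; have [d0 dP aHP] := rootH.
have d_eq0 x : d x = 0 -> x = v by have [//|/dP[_ ->]] := eqVneq x v.
have nv i y : S i y -> y != w i -> y != v.
  move=> Sy; apply: contraNneq => yv; move: (S_above Sy).
  by rewrite yv d0 leqn0 => /eqP/d_eq0->.
pose rank (u : graft) := match val u with
  | inl x => h1 x | inr (i, y) => i.+1 + (d y - d (w i)) end.
pose par (u : graft) := match val u with
  | inl x => base (par1 x)
  | inr (i, y) => if y == w i then
                    if i == 0 :> nat then base t else twig i.-1 (w i.-1)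
                  else twig i (parH y) end.
have rank_twig i y : i <= N -> S i y -> rank (twig i y) = i.+1 + (d y - d (w i)).
  by move=> iN Sy; rewrite /rank val_twig // inordK.
have par_twig i y : i <= N -> S i y -> par (twig i y) = if y == w i then
    if i == 0 then base t else twig i.-1 (w i.-1) else twig i (parH y).
  by move=> iN Sy; rewrite /par val_twig // inordK.
have twig_neq i y : i <= N -> S i y -> twig i y != base t.
  by move=> iN Sy; rewrite -val_eqE val_twig.
have fin : asymmetric graft -> rooting (base t) par rank -> is_tree graft.
  by move=> as_ r_; apply: rooting_tree r_ as_.
apply: fin.
  by move=> u u' /label_hom/asH; apply: contra => /label_hom.
split=> // [u|u u'].
- case: (graftP u) => [x xt|i y iN Sy _].
    have xt' : x != t by apply: contraNneq xt => ->.
    by have [] := h1P x xt'.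
  rewrite par_twig //; have [yw|yw] := eqVneq y (w i).
    have [i0|i0] := eqVneq i 0.
      rewrite adj_sym adj_base_twig // rank_twig // yw i0 w0_adj !eqxx subnn.
      by rewrite /rank /= h10.
    rewrite rank_twig // rank_twig ?adj_twig //; try lia.
    have := w_adj (i := i.-1); rewrite prednK ?lt0n // yw adj_sym => -> //.
    by rewrite /in_link prednK ?lt0n // !eqxx !orbT; split=> //; lia.
  have Sp := S_parent Sy yw; have [ap dp] := dP y (nv _ _ Sy yw).
  rewrite adj_twig // !rank_twig // ap /in_link eqxx; split=> //.
  by have := S_above Sp; rewrite dp; lia.
- case: (graftP u) => [x|i y iN Sy]; case: (graftP u') => [x'|j z jN Sz].
  + move=> xx'; have : adj x x' by [].
    have ne (x0 : T1) : x0 != t -> base x0 != base t.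
      by apply: contra => /eqP/(congr1 val)/= [->].
    by move=> /a1P[[/ne n e]|[/ne n e]]; [left|right]; rewrite /par /= -e.
  + rewrite adj_base_twig // => /and4P[_ /eqP xt /eqP i0 /eqP yw]; right.
    by rewrite twig_neq // par_twig // i0 yw eqxx xt.
  + rewrite adj_sym adj_base_twig // => /and4P[_ /eqP xt /eqP i0 /eqP yw]; left.
    by rewrite twig_neq // par_twig // i0 yw eqxx xt.
  + rewrite adj_twig // => /andP[yz].
    have low i' y' : S i' y' -> y' != v -> S i' (parH y') -> y' != w i'.
      move=> _ nv' Sp; apply: contraTneq (S_above Sp) => <-.
      by have [_ ->] := dP _ nv'; rewrite ltnn.
    case/or3P=> [/eqP ij|/and3P[/eqP ij /eqP yw /eqP zw]|/and3P[/eqP ij /eqP yw /eqP zw]].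
    * subst j; case/aHP: yz => -[n e]; [left|right]; rewrite twig_neq // par_twig //.
        by rewrite e in Sz *; rewrite (negbTE (low _ _ Sy n Sz)).
      by rewrite e in Sy *; rewrite (negbTE (low _ _ Sz n Sy)).
    * by right; rewrite twig_neq // par_twig // zw eqxx ij /= yw.
    * by left; rewrite twig_neq // par_twig // yw eqxx ij /= zw.
Qed.

End GraftTree.
End Graft.

(** * Branches at a vertex *)

Section Pieces.
Variables (H : digraph) (v a b c : H) (parH : H -> H) (d : H -> nat).
Hypothesis rootH : rooting v parH d.
Hypothesis br : branching v a b c.

(** The pieces 0, 1, 2 are the branches of [H] at [v] that contain [a], [b], [c];
    they are recognised by the ancestor at depth one. Piece 3 is the rest: [v]
    and its remaining branches. *)
Definition piece (y : H) : nat := index (iter (d y).-1 parH y) [:: a; b; c].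

(** The vertex of piece [m] closest to [v]; the default value [v] of [nth] is
    the right one for piece 3. *)
Definition top (m : nat) : H := nth v [:: a; b; c] m.

Lemma depth_eq0 y : (d y == 0) = (y == v).
Proof.
have [d0 dP _] := rootH; apply/eqP/eqP => [|->//].
by have [//|/dP[_ ->]] := eqVneq y v.
Qed.

Lemma top_adj m : m < 3 -> adj v (top m).
Proof. by case: br => _ ? ? ?; case: m => [|[|[|]]]. Qed.

Lemma top_neq m : m < 3 -> top m != v.
Proof. by move/top_adj; apply: contraTneq => ->; rewrite adj_irr. Qed.

Lemma depth_top m : m < 3 -> d (top m) = 1.
Proof.
move=> m3; have [d0 _ _] := rootH.
case: (rooting_adj rootH (top_adj m3)) => -[_]; last by rewrite d0.
by rewrite d0.
Qed.

Lemma top_notin : v \notin [:: a; b; c].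
Proof.
apply/negP => /(nthP v)[m m3 e]; by move: (top_neq m3); rewrite /top e eqxx.
Qed.

Lemma piece_top m : m <= 3 -> piece (top m) = m.
Proof.
have [d0 _ _] := rootH; have [u _ _ _] := br.
rewrite leq_eqVlt => /predU1P[->|m3].
  by rewrite /piece [top 3]/= d0 [iter _ _ _]/= memNindex ?top_notin.
by rewrite /piece depth_top // [iter _ _ _]/= index_uniq.
Qed.

Lemma piece_root : piece v = 3.
Proof. exact: (@piece_top 3). Qed.

Lemma piece_parent y : 1 < d y -> piece (parH y) = piece y.
Proof.
have [d0 dP _] := rootH => dy.
have yv : y != v by rewrite -depth_eq0; lia.
rewrite /piece; case: (dP y yv) => _ e; rewrite e in dy *.
by rewrite /= -[in RHS](prednK dy) iterSr.
Qed.

Lemma piece_lt3 y : piece y < 3 -> d y = 1 -> y = top (piece y).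
Proof. by move=> py dy; rewrite /top nth_index -?index_mem // dy. Qed.

Lemma piece_depth y : d (top (piece y)) <= d y.
Proof.
have [py|py] := ltnP (piece y) 3; last first.
  by rewrite /top nth_default //; have [-> _ _] := rootH.
rewrite depth_top // lt0n depth_eq0; apply: contraTneq py => ->.
by rewrite piece_root.
Qed.

Lemma piece_closed y : y != top (piece y) -> piece (parH y) = piece y.
Proof.
have [d0 dP _] := rootH => yt.
have [yv|yv] := eqVneq y v; first by rewrite yv piece_root eqxx in yt.
have [d1|d1] := ltnP 1 (d y); first exact: piece_parent.
have dy : d y = 1 by move: yv; rewrite -depth_eq0; lia.
have [py|py] := ltnP (piece y) 3.
  by rewrite {1}(piece_lt3 py dy) eqxx in yt.
have p3 : piece y = 3 by apply/eqP; rewrite eqn_leq py index_size.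
have /eqP : d (parH y) = 0 by case: (dP y yv) => _; rewrite dy => -[].
by rewrite depth_eq0 p3 => /eqP->; rewrite piece_root.
Qed.

(** The pieces are connected to each other only through the edges from [v] to
    [a], [b] and [c]. *)
Lemma adj_pieces y z : adj y z -> [\/ piece y = piece z,
   y = v /\ (piece z < 3 /\ z = top (piece z)) |
   z = v /\ (piece y < 3 /\ y = top (piece y))].
Proof.
have [d0 dP aP] := rootH.
have up x : x != v -> piece x = piece (parH x) \/
    parH x = v /\ (piece x < 3 /\ x = top (piece x)).
  move=> xv; have [e|e] := eqVneq x (top (piece x)); last first.
    by left; rewrite piece_closed.
  have p3 : piece x < 3.
    by rewrite ltnNge; apply: contra xv => p3; rewrite e /top nth_default.
  right; do !split=> //; have [_] := dP x xv.
  by rewrite {1}e depth_top // => -[/esym/eqP]; rewrite depth_eq0 => /eqP.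
case/aP => -[/up + ->] => -[e|e].
- by constructor 1.
- by constructor 3.
- by constructor 1.
- by constructor 2.
Qed.

End Pieces.

(** Lets one statement about the arcs at [v] cover both of their orientations. *)
Definition dir (G : digraph) (o : bool) (x y : G) : bool :=
  if o then is_arc x y else is_arc y x.

Lemma hom_dir (G G' : digraph) (g : G -> G') o x y :
  is_hom g -> dir o x y -> dir o (g x) (g y).
Proof. by move=> hg; case: o => /hg. Qed.

(** * Caterpillars *)

Section Caterpillar.
Variables (T1 H : digraph) (t : T1) (f : T1 -> H).
Variables (v a b c : H) (parH : H -> H) (d : H -> nat) (q : seq H) (L : nat).
Hypothesis rootH : rooting v parH d.
Hypothesis br : branching v a b c.

Let pc := piece a b c parH d.
Let tp := top v a b c.
Let K := size q.

(** The spine of the caterpillar first runs through [q], which leads from [f t]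
    to [v], without decorations. From then on it alternates between a neighbour
    of [v], taken from [a], [b], [c] in cyclic order and carrying its branch, and
    [v], carrying piece 3; [kind] is the piece carried at a position of this
    part. Each copy of [v] thus sees only two of the three branches. *)
Definition kind (i : nat) : nat := if odd i then 3 else i./2 %% 3.

Definition spine (i : nat) : H := if i < K then nth v q i else tp (kind (i - K)).

Definition deco (i : nat) : pred H := fun y =>
  if i < K then y == nth v q i else pc y == kind (i - K).

(* The bound on non-backtracking walks is applied to the first [L] steps after
   [q]; [backtrack_hom] looks up to four positions further. *)
Let N := K + L + 4.

Lemma kind_le3 i : kind i <= 3.
Proof. by rewrite /kind; case: odd => //; rewrite ltnW // ltn_pmod. Qed.

Lemma deco_root i : deco i (spine i).
Proof.
rewrite /deco /spine; case: ltnP => // _.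
by rewrite /pc (piece_top rootH br) // kind_le3.
Qed.

Lemma deco_above i y : deco i y -> d (spine i) <= d y.
Proof.
rewrite /deco /spine; case: ltnP => [_ /eqP->//|_ /eqP<-].
exact: piece_depth rootH br y.
Qed.

Lemma deco_parent i y : deco i y -> y != spine i -> deco i (parH y).
Proof.
rewrite /deco /spine; case: ltnP => [_ ->//|_ /eqP<- yt].
by rewrite /pc (piece_closed rootH br).
Qed.

Lemma kindS_adj i : adj (tp (kind i)) (tp (kind i.+1)).
Proof.
by rewrite /kind /=; case: odd; last rewrite adj_sym; apply: (top_adj br); rewrite ltn_pmod.
Qed.

Lemma deco_separates i y : deco i v -> y \in [:: a; b; c] -> ~~ deco i y.
Proof.
move=> + yin; have [m m3 <-] := nthP v yin; rewrite -[nth _ _ _]/(tp m).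
rewrite /deco; case: ltnP => _ /eqP<-; first exact: top_neq br _ m3.
rewrite /pc (piece_root rootH br) (piece_top rootH br) ?(ltnW m3) //.
by rewrite neq_ltn m3.
Qed.

Definition caterpillar : digraph := graft t f N spine deco.

Let tw i y : caterpillar := twig t f N spine deco (K + i) y.

Lemma dir_twig o i y z : K + i <= N -> pc y = kind i -> pc z = kind i ->
  dir o y z -> dir o (tw i y) (tw i z).
Proof.
move=> iN py pz; have S x : pc x = kind i -> deco (K + i) x.
  by move=> px; rewrite /deco ltnNge leq_addr /= addKn px.
by case: o => yz; rewrite /dir /tw arc_twig ?S //; rewrite [is_arc _ _]yz /in_link eqxx.
Qed.

Lemma deco_tp i : deco (K + i) (tp (kind i)).
Proof. by have := deco_root (K + i); rewrite /spine ltnNge leq_addr /= addKn. Qed.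

Lemma dir_step o i : K + i.+1 <= N ->
  dir o (tp (kind i)) (tp (kind i.+1)) ->
  dir o (tw i (tp (kind i))) (tw i.+1 (tp (kind i.+1))).
Proof.
move=> iN; have iN' : K + i <= N by lia.
have e j : spine (K + j) = tp (kind j) by rewrite /spine ltnNge leq_addr /= addKn.
by case: o => yz; rewrite /dir /tw arc_twig ?deco_tp //;
  rewrite [is_arc _ _]yz /in_link !e !eqxx !addnS eqxx ?orbT.
Qed.

Section NoHom.
Variable k : caterpillar -> T1.
Hypothesis k_hom : is_hom k.
Hypothesis asT1 : asymmetric T1.

Let u i := k (tw i (tp (kind i))).

(** Three consecutive branches at positions [2j], [2j+2], [2j+4] are copies of
    the branches of [a], [b], [c] in some order. If the walk [u] backtracks in
    between, their images and that of piece 3 at position [2j+3] fit together to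
    a homomorphism from [H]. Only the edge from the copy of [v] at [2j+3] to the
    branch at [2j] is missing in the caterpillar. Its image is present when both
    copies of [v] around [2j+2] have the same image, and also when the branches
    at [2j] and [2j+2] have the same image of their tops: in that case these two
    tops are joined to [v] by arcs of the same orientation. *)
Lemma backtrack_hom j : K + j.*2 + 4 <= N ->
  u j.*2 = u j.*2.+2 \/ u j.*2.+1 = u j.*2.+3 -> hom_le H T1.
Proof.
move=> jN bt.
have kS i : kind i.*2.+1 = 3 by rewrite /kind /= odd_double.
have kD i : kind i.*2 = i %% 3 by rewrite /kind odd_double doubleK.
have tp3 : tp 3 = v by [].
have step o i : K + i.*2.+2 <= N ->
    (dir o v (tp (i %% 3)) -> dir o (u i.*2.+1) (u i.*2)) /\
    (dir o v (tp (i.+1 %% 3)) -> dir o (u i.*2.+1) (u i.*2.+2)).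
  move=> iN; split=> vo.
    have iN' : K + i.*2.+1 <= N by lia.
    have := @dir_step (~~ o) i.*2 iN'; rewrite kS kD tp3 /u kS kD tp3.
    by move=> /(_ _)/(hom_dir k_hom); case: (o) vo => vo; apply.
  have := @dir_step o i.*2.+1 iN; rewrite -doubleS kS kD tp3 /u kS kD tp3.
  by move=> /(_ vo)/(hom_dir k_hom).
have last_step o : dir o v (tp (j %% 3)) -> dir o (u j.*2.+3) (u j.*2).
  have jN' : K + j.*2.+2 <= N by lia.
  have jN2 : K + j.+1.*2.+2 <= N by lia.
  move=> vo; have h1 := (step o j jN').1 vo.
  case: bt => e; last by rewrite -e.
  have [l1|l1] : dir o v (tp (j.+1 %% 3)) \/ dir (~~ o) v (tp (j.+1 %% 3)).
  - have : adj v (tp (j.+1 %% 3)) by apply: (top_adj br); rewrite ltn_pmod.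
    by rewrite /adj; case: (o) => /orP[]; [left|right|right|left].
  - by rewrite e; apply: (step o j.+1 jN2).1.
  - have := (step _ j jN').2 l1; rewrite -e.
    by case: (o) h1 => /= h1 h2; have := asT1 h1; rewrite h2.
(* Which of the branches [j], [j+1], [j+2] of the caterpillar is a copy of
   piece [m]. *)
pose idx (m : nat) := if m == j %% 3 then j else if m == j.+1 %% 3 then j.+1 else j.+2.
have idxP m : m < 3 -> idx m %% 3 = m.
  move=> m3; rewrite /idx; case: eqP => [->//|n1]; case: eqP => [->//|n2]; lia.
have idxj m : idx m <= j.+2 by rewrite /idx; case: ifP => _; last case: ifP => _; lia.
pose site m := if m < 3 then (idx m).*2 else j.*2.+3.
have kind_site m : m <= 3 -> kind (site m) = m.
  rewrite /site leq_eqVlt => /predU1P[->/=|m3]; first by rewrite -[j.*2.+3]/(j.+1.*2.+1) kS.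
  by rewrite m3 kD idxP.
have siteN m : K + site m <= N by rewrite /site; case: ifP => _; have := idxj m; lia.
pose F y := k (tw (site (pc y)) y).
have pc3 y : pc y <= 3 by apply: index_size.
have Fv o m : m < 3 -> dir o v (tp m) -> dir o (F v) (F (tp m)).
  move=> m3 vo; rewrite /F /pc (piece_root rootH br) (piece_top rootH br) ?(ltnW m3) //.
  have -> : k (tw (site 3) v) = u j.*2.+3.
    by rewrite /u -[j.*2.+3]/(j.+1.*2.+1) kS.
  have -> : k (tw (site m) (tp m)) = u (site m) by rewrite /u kind_site ?(ltnW m3).
  rewrite /site m3; move: vo; rewrite -{1}(idxP m m3) /idx.
  case: eqP => _; first exact: last_step.
  have jN2 : K + j.+1.*2.+2 <= N by lia.
  by case: eqP => _; [apply: (step o j.+1 jN2).1 | apply: (step o j.+1 jN2).2].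
exists F => y z yz; have : adj y z by rewrite /adj yz.
case/(adj_pieces rootH br) => [e|[yv [z3 zt]]|[zv [y3 yt]]].
- rewrite /F -[pc z]e; apply: k_hom; apply: (@dir_twig true) => //.
    by rewrite kind_site.
  by rewrite kind_site // /pc e.
- by rewrite yv zt; apply: (Fv true) => //; rewrite -[tp _]zt -yv.
- by rewrite zv yt; apply: (Fv false) => //; rewrite -[tp _]yt -zv.
Qed.

(** The walk [u] in [T1] never backtracks, by [backtrack_hom]. *)
Lemma caterpillar_bound (par1 : T1 -> T1) (h1 : T1 -> nat) (B : nat) :
  rooting t par1 h1 -> (forall x, h1 x <= B) -> ~ hom_le H T1 -> L <= B.*2.
Proof.
move=> R1 hB nle; apply: (nonbacktracking_bound R1 (u := u)) => // i iL.
  apply: hom_adj k_hom _; have iN : K + i.+1 <= N by rewrite /N; lia.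
  case/orP: (kindS_adj i) => ar; apply/orP; [left|right].
    exact: (@dir_step true i iN ar).
  exact: (@dir_step false i iN ar).
apply/eqP => e; apply: nle; apply: (@backtrack_hom i./2).
  by rewrite /N; lia.
by move: e; rewrite -{1 2}(odd_double_half i); case: odd; [right|left].
Qed.

End NoHom.

Hypothesis q_path : path (@adj H) (f t) q.
Hypothesis q_last : last (f t) q = v.
Hypothesis q_gt0 : 0 < size q.

Lemma spine_adj0 : adj (f t) (spine 0).
Proof. by rewrite /spine q_gt0; case: (q) q_path q_gt0 => //= ? ? /andP[]. Qed.

Lemma spine_adj i : adj (spine i) (spine i.+1).
Proof.
rewrite /spine; case: (ltnP i.+1 K) => iK.
  rewrite (ltnW iK); have /(pathP v)/(_ i.+1 iK) := q_path.
  by case: (q) iK => //= x s; rewrite /K /= => iK; rewrite (set_nth_default v).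
case: (ltnP i K) => iK'.
  have e : i.+1 = K by apply/eqP; rewrite eqn_leq iK' iK.
  rewrite -e subnn (_ : nth v q i = v); first exact: (top_adj br (m := 0)).
  by rewrite -[RHS]q_last -nth_last -[(size q).-1]/(K.-1) -e; apply: set_nth_default.
by rewrite subSn //; apply: kindS_adj.
Qed.

End Caterpillar.

(** * Density *)

(** The edge [t t'] lets the spine begin with a zigzag that folds back into [T1];
    it is longer than the depth of [H], as [graft_no_section] requires. The
    repeating part of the caterpillar exceeds the length of all non-backtracking
    walks in [T1]. *)
Lemma rigid_density (T1 H : digraph) (t t' : T1) (v a b c : H) :
  is_tree T1 -> is_tree H -> (forall e : H -> H, is_hom e -> injective e) ->
  branching v a b c -> adj t t' -> hom_lt T1 H ->
  exists T : digraph, [/\ is_tree T, hom_lt T1 T & hom_lt T H].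
Proof.
move=> tT1 tH rigid br tt' [[f hf] nle].
have asH := tree_asym tH; have asT1 := tree_asym tT1.
have [parH [d rootH]] := tree_rooting v tH.
have [par1 [h1 root1]] := tree_rooting t tT1.
pose M := (\max_x d x).+1; pose B := \max_x h1 x.
have dM x : d x < M by rewrite ltnS leq_bigmax.
have hB x : h1 x <= B by rewrite leq_bigmax.
have /connectP[p p_path p_last] := tH.1.2 (f t) v.
pose zig i := if odd i then f t else f t'.
pose q := mkseq zig M.*2 ++ p.
have zig_last : last (f t) (mkseq zig M.*2) = f t.
  rewrite -nth_last size_mkseq nth_mkseq; last by rewrite /M; lia.
  by rewrite /zig /M /= odd_double.
have q_path : path (@adj H) (f t) q.
  rewrite cat_path zig_last [X in _ && X]p_path andbT.
  apply/(pathP (f t)) => i; rewrite size_mkseq => iM.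
  rewrite nth_mkseq //; case: i iM => [|i] iM /=; first exact: hom_adj.
  rewrite nth_mkseq 1?ltnW // /zig /=.
  by case: odd => /=; [|rewrite adj_sym]; apply: hom_adj.
have q_last : last (f t) q = v by rewrite last_cat zig_last -p_last.
have sq : M.*2 <= size q by rewrite size_cat size_mkseq leq_addr.
have q_gt0 : 0 < size q by apply: leq_trans sq; rewrite /M; lia.
pose L := B.*2.+1.
pose T := caterpillar t f v a b c parH d q L.
have root := deco_root q rootH br.
have T_hom : is_hom (@label _ _ t f _ _ _ : T -> H) by apply: label_hom.
exists T; split.
- apply: (graft_tree hf rootH root) => //.
  + exact: deco_above rootH br.
  + exact: deco_parent rootH br.
  + exact: spine_adj0.
  + by move=> i _; apply: (spine_adj br q_path q_last).
- split; first by exists (@base _ _ t f _ _ _); apply: base_hom.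
  case=> k hk; have := caterpillar_bound rootH br hk asT1 root1 hB nle.
  by rewrite /L ltnn.
- split; first by exists (@label _ _ t f _ _ _ : T -> H).
  case=> g hg; have [s [hs sK]] := rigid_section rigid hg T_hom.
  apply: (graft_no_section hf rootH asH nle br _ tt' _ hs sK).
  + exact: deco_separates rootH br.
  + move=> i y [x ix]; have iM : i < M.*2 by have := dM x; lia.
    by rewrite /deco (leq_trans iM sq) nth_cat size_mkseq iM nth_mkseq.
Qed.

(** Stands in for a tree [T1] without arcs, which has no edge to zigzag over. *)
Definition single_arc : digraph :=
  @Digraph bool (fun x y => ~~ x && y) (fun x => andNb x).

Lemma single_arc_tree : is_tree single_arc.
Proof.
apply: (@rooting_tree single_arc false (fun=> false) nat_of_bool); last by do 2!case.
split=> //; first by case.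
by case=> -[] // _; [left|right].
Qed.

Theorem theorem1p1 (T1 T2 : digraph) :
  is_tree T1 -> is_tree T2 -> hom_lt T1 T2 -> is_proper T2 ->
  exists T : digraph, [/\ is_tree T, hom_lt T1 T & hom_lt T T2].
Proof.
move=> tT1 tT2 lt12 prop2.
have [C [coreC [r [hr r_surj]] rigid]] := core_exists T2.
have [[CT2 T2C] _] := coreC.
have tC : is_tree C.
  apply: (@sub_tree _ T2 (val : C -> T2)) => //.
  - by move=> x y /sub_arcsP/and3P[].
  - exact: val_inj.
  - have [/card_gt0P[x0 _] conn] := tT2.1; split.
      by apply/card_gt0P; exists (r x0).
    move=> y z; have [x <-] := r_surj y; have [x' <-] := r_surj z.
    have /connectP[p + ->] := conn x x'; elim: p x => //= x1 p IH x /andP[xx1 /IH].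
    by apply: connect_trans; apply/connect1/(hom_adj hr).
have [v [a [b [c br]]]] : exists v a b c : C, branching v a b c.
  have [|no] := boolP [exists v : C, exists a : C, exists b : C, exists c : C,
      [&& uniq [:: a; b; c], adj v a, adj v b & adj v c]].
    case/existsP=> v /existsP[a /existsP[b /existsP[c /and4P[? ? ? ?]]]].
    by exists v, a, b, c.
  case: (prop2 C coreC); apply: nonbranching_path => // v a b c [h1 h2 h3 h4].
  case/negP: no; apply/existsP; exists v; apply/existsP; exists a.
  by apply/existsP; exists b; apply/existsP; exists c; apply/and4P.
have lt1C : hom_lt T1 C.
  split; first exact: hom_le_trans lt12.1 T2C.
  by move=> /(hom_le_trans T2C); apply: lt12.2.
suff [T [tT lt1 [TC CT]]] : exists T, [/\ is_tree T, hom_lt T1 T & hom_lt T C].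
  exists T; split=> //; split; first exact: hom_le_trans TC CT2.
  by move=> /(hom_le_trans CT2).
have [/existsP[t /existsP[t' tt']]|no] := boolP [exists t : T1, exists t', adj t t'].
  exact: rigid_density tT1 tC rigid br tt' lt1C.
have le1 : hom_le T1 single_arc.
  exists (fun=> false) => x y xy; case/existsP: no; exists x.
  by apply/existsP; exists y; rewrite /adj xy.
have ltC : hom_lt single_arc C.
  have [u va _ _] := br.
  have arcC : hom_le single_arc C.
    case/orP: va => ar; [exists (fun x => if x then a else v)|
      exists (fun x => if x then v else a)]; by case=> [][].
  (* A homomorphism [g] from [C] would be injective on [a], [b], [c]. *)
  split=> // -[g hg]; have [e he] := arcC.
  have gi : injective g := inj_compr (rigid _ (is_hom_comp hg he)).
  have := max_card (mem (map g [:: a; b; c])).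
  have /card_uniqP -> : uniq (map g [:: a; b; c]) by rewrite (map_inj_uniq gi).
  by rewrite size_map [#|_|]card_bool.
have [T [tT [arcT nT] ltT]] :=
  rigid_density (t := false : single_arc) (t' := true : single_arc)
    single_arc_tree tC rigid br isT ltC.
exists T; split=> //; split; first exact: hom_le_trans le1 arcT.
move=> TT1; apply: nT; exact: hom_le_trans TT1 le1.
Qed.
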